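(* $$(B_4(\mathbb{D}^2))^{(3)}\cong\mathbb{F}_5(z_1,\ldots,z_5)\rtimes(\mathbb{F}_2(u,v))^{(2)},$$ where the action is the restriction to $(\mathbb{F}_2(u,v))^{(2)}$ of the action of the free group $\mathbb{F}_2(u,v)$ on the free group $\mathbb{F}_5(z_1,\ldots,z_5)$ given by $$\begin{aligned} uz_1u^{-1}&=z_2,\\ uz_2u^{-1}&=z_2z_1^{-1}z_5z_3z_2^{-1}z_4^{-1}z_2,\\ uz_3u^{-1}&=z_2^2z_3^{-1}z_5^2z_3z_2^{-1}z_4^{-1}z_2,\\ uz_4u^{-1}&=z_2z_1^{-1}z_5z_1z_2^{-1},\\ uz_5u^{-1}&=z_2^2z_3^{-1}z_5^2, \end{aligned}$$ and, writing $w_1=z_1^{-1}z_3z_2^{-1}z_4^{-1}z_2$, $$\begin{aligned} vz_1v^{-1}&=w_1,\\ vz_2v^{-1}&=w_1^2z_3^{-1}z_5z_2z_3^{-1}z_5z_4^{-1}z_2,\\ vz_3v^{-1}&=w_1^2z_1^{-1}(z_2z_3^{-1}z_5)^2z_4^{-1}z_2,\\ vz_4v^{-1}&=w_1^2z_3^{-1}z_5z_2w_1^{-2},\\ vz_5v^{-1}&=w_1^2z_1^{-1}(z_2z_3^{-1}z_5)^2. \end{aligned}$$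
   Context: $\mathbb{D}^2$ is the closed $2$-disc and $B_4(\mathbb{D}^2)$ is Artin's $4$-string braid group, generated by $\sigma_1,\sigma_2,\sigma_3$ subject to $\sigma_1\sigma_3=\sigma_3\sigma_1$ and $\sigma_i\sigma_{i+1}\sigma_i=\sigma_{i+1}\sigma_i\sigma_{i+1}$ for $i=1,2$. Derived series: $G^{(0)}=G$, $G^{(i)}=[G^{(i-1)},G^{(i-1)}]$. $\mathbb{F}_k(y_1,\ldots,y_k)$ is the free group of rank $k$ on $y_1,\ldots,y_k$. In $N\rtimes Q$ the normal subgroup is $N$, and $qnq^{-1}$ denotes the image of $n\in N$ under the action of $q\in Q$. *)

(* Defs.v *)
From HB Require Import structures.
From mathcomp Require Import all_boot.
From mathcomp Require Import boolp.

Set Implicit Arguments.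
Unset Strict Implicit.
Unset Printing Implicit Defensive.

Local Open Scope quotient_scope.
Local Open Scope group_scope.

Notation ord n i := (@Ordinal n i isT).

(* The letter (i, false) stands for the generator i, and (i, true) for its
   inverse. *)
Definition word (I : choiceType) := seq (I * bool).

Definition word_inv (I : choiceType) (w : word I) : word I :=
  rev [seq (l.1, ~~ l.2) | l <- w].

(* The pair (w1, w2) stands for the relation w1 = w2. *)
Definition relations (I : choiceType) := seq (word I * word I).

Inductive word_eqv (I : choiceType) (R : relations I) : word I -> word I -> Prop :=
| WordRel w1 w2 : (w1, w2) \in R -> word_eqv R w1 w2
| WordCancel i b : word_eqv R [:: (i, b); (i, ~~ b)] [::]
| WordRefl w : word_eqv R w w
| WordSym w1 w2 : word_eqv R w1 w2 -> word_eqv R w2 w1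
| WordTrans w1 w2 w3 :
    word_eqv R w1 w2 -> word_eqv R w2 w3 -> word_eqv R w1 w3
| WordCat w1 w2 w3 w4 :
    word_eqv R w1 w2 -> word_eqv R w3 w4 -> word_eqv R (w1 ++ w3) (w2 ++ w4).

Section PresentedGroup.
Variables (I : choiceType) (R : relations I).

Definition word_eqb (w1 w2 : word I) : bool := `[< word_eqv R w1 w2 >].

Lemma word_eqb_equiv : equiv_class_of word_eqb.
Proof.
split=> [w|w1 w2|w2 w1 w3].
- exact/asboolP/WordRefl.
- by apply/asboolP/asboolP; apply: WordSym.
- by move=> /asboolP h12 /asboolP h23; apply/asboolP/(WordTrans h12 h23).
Qed.

Canonical word_eqb_equiv_rel := EquivRelPack word_eqb_equiv.

(* The group < I | R >. *)
Definition presented := {eq_quot word_eqb}.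

HB.instance Definition _ := Choice.on presented.
HB.instance Definition _ := EqQuotient.on presented.

Lemma piP (w1 w2 : word I) :
  word_eqv R w1 w2 <-> \pi_presented w1 = \pi_presented w2.
Proof. by split=> [h|/eqmodP/asboolP //]; apply/eqmodP/asboolP. Qed.

Lemma reprP (w : word I) : word_eqv R (repr (\pi_presented w)) w.
Proof. by apply/piP; rewrite reprK. Qed.

Lemma presentedW (P : presented -> Prop) :
  (forall w, P (\pi_presented w)) -> forall x, P x.
Proof. by move=> h x; rewrite -[x]reprK. Qed.

Lemma word_inv_cat (w1 w2 : word I) :
  word_inv (w1 ++ w2) = word_inv w2 ++ word_inv w1.
Proof. by rewrite /word_inv map_cat rev_cat. Qed.

Lemma word_invK : involutive (@word_inv I).
Proof.
move=> w; rewrite /word_inv map_rev revK -map_comp -[RHS]map_id.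
by apply: eq_map => -[i b] /=; rewrite negbK.
Qed.

Lemma word_mulV (w : word I) : word_eqv R (w ++ word_inv w) [::].
Proof.
elim: w => [|[i b] w IHw]; first exact: WordRefl.
rewrite -cat1s word_inv_cat -catA (catA w).
apply: WordTrans (WordCancel R i b).
rewrite -[X in word_eqv _ _ X]/([:: (i, b)] ++ ([::] ++ [:: (i, ~~ b)])).
by apply: WordCat; [apply: WordRefl | apply: WordCat IHw (WordRefl _ _)].
Qed.

Lemma word_mulV' (w : word I) : word_eqv R (word_inv w ++ w) [::].
Proof. by rewrite -{2}(word_invK w); apply: word_mulV. Qed.

Lemma word_inv_eqv (w1 w2 : word I) :
  word_eqv R w1 w2 -> word_eqv R (word_inv w1) (word_inv w2).
Proof.
move=> h; rewrite -[word_inv w1]cats0 -[word_inv w2]cat0s.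
apply: (@WordTrans _ _ _ (word_inv w1 ++ (w2 ++ word_inv w2))).
  by apply: WordCat; [apply: WordRefl | apply/WordSym/word_mulV].
rewrite catA; apply: WordCat (WordRefl _ _).
apply: WordTrans (word_mulV' w1).
by apply: WordCat; [apply: WordRefl | apply: WordSym].
Qed.

Definition presented_mul (x y : presented) : presented :=
  \pi_presented (repr x ++ repr y).
Definition presented_one : presented := \pi_presented [::].
Definition presented_inv (x : presented) : presented := \pi_presented (word_inv (repr x)).

Lemma presented_mulE (w1 w2 : word I) :
  presented_mul (\pi_presented w1) (\pi_presented w2) = \pi_presented (w1 ++ w2).
Proof. by apply/piP/WordCat; apply: reprP. Qed.

Lemma presented_invE (w : word I) :
  presented_inv (\pi_presented w) = \pi_presented (word_inv w).
Proof. exact/piP/word_inv_eqv/reprP. Qed.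

Lemma presented_mulgA : associative presented_mul.
Proof.
move=> x y z; elim/presentedW: x => x; elim/presentedW: y => y; elim/presentedW: z => z.
by rewrite !presented_mulE catA.
Qed.

Lemma presented_mul1g : left_id presented_one presented_mul.
Proof. by move=> x; elim/presentedW: x => x; rewrite presented_mulE. Qed.

Lemma presented_mulg1 : right_id presented_one presented_mul.
Proof. by move=> x; elim/presentedW: x => x; rewrite presented_mulE cats0. Qed.

Lemma presented_mulVg : left_inverse presented_one presented_inv presented_mul.
Proof.
move=> x; elim/presentedW: x => x; rewrite presented_invE presented_mulE.
exact/piP/word_mulV'.
Qed.

Lemma presented_mulgV : right_inverse presented_one presented_inv presented_mul.
Proof.
move=> x; elim/presentedW: x => x; rewrite presented_invE presented_mulE.
exact/piP/word_mulV.
Qed.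

HB.instance Definition _ := isGroup.Build presented
  presented_mulgA presented_mul1g presented_mulg1
  presented_mulVg presented_mulgV.

Definition pgen (i : I) : presented := \pi_presented [:: (i, false)].

End PresentedGroup.

Definition free_group (k : nat) : groupType := @presented 'I_k [::].
Definition fgen (k : nat) (i : 'I_k) : free_group k := pgen [::] i.

Definition braid4_relations : relations 'I_3 :=
  let s1 := (ord 3 0, false) in
  let s2 := (ord 3 1, false) in
  let s3 := (ord 3 2, false) in
  [:: ([:: s1; s3], [:: s3; s1]);
      ([:: s1; s2; s1], [:: s2; s1; s2]);
      ([:: s2; s3; s2], [:: s3; s2; s3])].

Definition braid_group4 : groupType := presented braid4_relations.

Section DerivedSeries.
Variable G : groupType.

Definition generated (A : {pred G}) : {pred G} := fun x =>
  `[< forall H : {pred G}, group_closed H -> {subset A <= H} -> x \in H >].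

Definition commutators (A B : {pred G}) : {pred G} := fun z =>
  `[< exists x y : G, [/\ x \in A, y \in B & z = [~ x, y]] >].

Definition derived_series (n : nat) : {pred G} :=
  iter n (fun H => generated (commutators H H)) predT.

Lemma generated_group_closed (A : {pred G}) : group_closed (generated A).
Proof.
split=> [|x y /asboolP hx /asboolP hy]; apply/asboolP=> H clH sAH.
  by case: clH.
by case: (clH) => _ /(_ x y) -> //; [apply: hx | apply: hy].
Qed.

Lemma derived_series_group_closed (n : nat) : group_closed (derived_series n).
Proof. by case: n => [|n]; [split | apply: generated_group_closed]. Qed.

Definition derived_group (n : nat) := {x : G | derived_series n x}.

HB.instance Definition _ n := SubChoice.on (derived_group n).
HB.instance Definition _ n :=
  SubChoice_isSubGroup.Build G (derived_series n) (derived_group n)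
    (derived_series_group_closed n).

End DerivedSeries.

Record group_action (Q N : groupType) := GroupAction {
  act :> Q -> N -> N;
  act1q : forall n, act 1 n = n;
  actMq : forall q r n, act (q * r) n = act q (act r n);
  actMn : forall q, {morph act q : m n / m * n}
}.

Lemma act_n1 (Q N : groupType) (phi : group_action Q N) q : phi q 1 = 1.
Proof. by apply: (mulgI (phi q 1)); rewrite -actMn !mulg1. Qed.

Section DerivedAction.
Variables (Q N : groupType) (phi : group_action Q N) (n : nat).

Definition derived_act (q : derived_group Q n) : N -> N := phi (val q).

Lemma derived_act1q x : derived_act 1 x = x.
Proof. by rewrite /derived_act gmulf1 act1q. Qed.

Lemma derived_actMq q r x :
  derived_act (q * r) x = derived_act q (derived_act r x).
Proof. by rewrite /derived_act gmulfM actMq. Qed.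

Lemma derived_actMn q : {morph derived_act q : x y / x * y}.
Proof. by move=> x y; apply: actMn. Qed.

Definition derived_action : group_action (derived_group Q n) N :=
  GroupAction derived_act1q derived_actMq derived_actMn.

End DerivedAction.

Section SemidirectProduct.
Variables (Q N : groupType) (phi : group_action Q N).

(* N ><| Q: the pair (n, q) stands for the product n q, with
   q n q^-1 = phi q n. *)
Definition semidirect (phi : group_action Q N) : Type := (N * Q)%type.
Local Notation S := (semidirect phi).

HB.instance Definition _ := Choice.on S.

Definition semidirect_mul (x y : S) : S := (x.1 * phi x.2 y.1, x.2 * y.2).
Definition semidirect_one : S := (1, 1).
Definition semidirect_inv (x : S) : S := (phi x.2^-1 x.1^-1, x.2^-1).

Lemma semidirect_mulgA : associative semidirect_mul.
Proof.
by move=> x y z; rewrite /semidirect_mul /= actMn actMq !mulgA.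
Qed.

Lemma semidirect_mul1g : left_id semidirect_one semidirect_mul.
Proof. by case=> n q; rewrite /semidirect_mul /= act1q !mul1g. Qed.

Lemma semidirect_mulg1 : right_id semidirect_one semidirect_mul.
Proof. by case=> n q; rewrite /semidirect_mul /= act_n1 !mulg1. Qed.

Lemma semidirect_mulVg :
  left_inverse semidirect_one semidirect_inv semidirect_mul.
Proof.
by case=> n q; rewrite /semidirect_mul /= -actMn !mulVg act_n1.
Qed.

Lemma semidirect_mulgV :
  right_inverse semidirect_one semidirect_inv semidirect_mul.
Proof.
by case=> n q; rewrite /semidirect_mul /= -actMq !mulgV act1q mulgV.
Qed.

HB.instance Definition _ := isGroup.Build S
  semidirect_mulgA semidirect_mul1g semidirect_mulg1
  semidirect_mulVg semidirect_mulgV.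

End SemidirectProduct.

Definition isomorphic (G H : groupType) : Prop :=
  exists f : {multiplicative G -> H}, bijective f.

(* Main.v *)
Require Import Defs.
From HB Require Import structures.
From mathcomp Require Import all_boot.
From mathcomp Require Import boolp.

Set Implicit Arguments.
Unset Strict Implicit.
Unset Printing Implicit Defensive.

Local Open Scope group_scope.

(* Write B3 and B4 for the braid groups. B4 is the semidirect product of the
   free group on a = s3 s1^-1 and b = s2 a s2^-1 by B3 = <x, y>, and B3 is the
   semidirect product of the free group on u = y x^-1 and v = x u x^-1 by the
   infinite cyclic group <x>. Hence every element of the third derived group of
   B4 is n q with q in the second derived group of <u, v> and n in <a, b>, and
   it remains to find which n occur. The first two derived groups contain
   <a, b>; modulo 2, the abelianization of <a, b> is a Klein four-group on which
   the derived group of <u, v> acts trivially, so that n is trivial in it.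
   Conversely [u^-1, v] sends a to a conjugate of a^-1, which yields a^2, and
   then all of the kernel of <a, b> -> (Z/2)^2. By Reidemeister-Schreier this
   kernel is free on z1 = a^2, z2 = b^2, z3 = (ab)^2, z4 = b a^2 b^-1 and
   z5 = a b^2 a^-1, and the given formulas are those of the conjugations by u
   and v. *)

Arguments act : simpl never.

(** * Group homomorphisms *)

Record hom (G H : groupType) := Hom {
  hom_fun :> G -> H;
  homM : {morph hom_fun : x y / x * y}
}.

Arguments hom_fun : simpl never.

Lemma morph_group1 (G H : groupType) (f : G -> H) :
  {morph f : x y / x * y} -> f 1 = 1.
Proof. by move=> fM; apply: (mulgI (f 1)); rewrite -fM !mulg1. Qed.

Lemma morph_groupV (G H : groupType) (f : G -> H) :
  {morph f : x y / x * y} -> {morph f : x / x^-1}.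
Proof.
move=> fM x; apply: (mulgI (f x)).
by rewrite -fM !mulgV (morph_group1 fM).
Qed.

Section HomTheory.
Variables (G H : groupType) (f : hom G H).

Lemma hom1 : f 1 = 1.
Proof. exact/morph_group1/homM. Qed.
Lemma homV : {morph f : x / x^-1}.
Proof. exact/morph_groupV/homM. Qed.
Lemma homF : {morph f : x y / x / y}.
Proof. by move=> x y; rewrite homM homV. Qed.
Lemma homR : {morph f : x y / [~ x, y]}.
Proof. by move=> x y; rewrite !homM !homV. Qed.

End HomTheory.

(** * Homomorphisms out of presented groups *)

Section Bijections.
Variable T : Type.

(** Actions are obtained as homomorphisms into the group of bijections under composition, so a
    presented group acts once the bijections of its generators satisfy the relations. The inverse is
    carried as data, which makes inverse generators act by explicit formulas. *)
Record bijection := Bijection {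
  bij_fun :> T -> T;
  bij_inv : T -> T;
  bij_funK : cancel bij_fun bij_inv;
  bij_invK : cancel bij_inv bij_fun
}.

HB.instance Definition _ := gen_eqMixin bijection.
HB.instance Definition _ := gen_choiceMixin bijection.

Lemma bij_ext (f g : bijection) : f =1 g -> f = g.
Proof.
case: f g => [f f' fK f'K] [g g' gK g'K] /= /funext eq_fg.
rewrite -{}eq_fg in gK g'K *.
have /funext eq_fg' : f' =1 g' by move=> x; rewrite -[LHS]gK f'K.
rewrite -{}eq_fg' in gK g'K *.
by congr Bijection; apply: Prop_irrelevance.
Qed.

Definition bij_mul (f g : bijection) : bijection :=
  Bijection (can_comp (bij_funK f) (bij_funK g))
            (can_comp (bij_invK g) (bij_invK f)).
Definition bij_one : bijection :=
  @Bijection id id (fun=> erefl) (fun=> erefl).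
Definition bij_opp (f : bijection) : bijection :=
  Bijection (bij_invK f) (bij_funK f).

Lemma bij_mulgA : associative bij_mul.
Proof. by move=> f g h; apply: bij_ext. Qed.
Lemma bij_mul1g : left_id bij_one bij_mul.
Proof. by move=> f; apply: bij_ext. Qed.
Lemma bij_mulg1 : right_id bij_one bij_mul.
Proof. by move=> f; apply: bij_ext. Qed.
Lemma bij_mulVg : left_inverse bij_one bij_opp bij_mul.
Proof. by move=> f; apply: bij_ext => x; apply: bij_funK. Qed.
Lemma bij_mulgV : right_inverse bij_one bij_opp bij_mul.
Proof. by move=> f; apply: bij_ext => x; apply: bij_invK. Qed.

HB.instance Definition _ := isGroup.Build bijection
  bij_mulgA bij_mul1g bij_mulg1 bij_mulVg bij_mulgV.

End Bijections.

Section Lift.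
Variables (I : choiceType) (R : relations I).

Lemma presented_ind (P : presented R -> Prop) :
  P 1 -> (forall x y, P x -> P y -> P (x * y)) -> (forall x, P x -> P x^-1) ->
  (forall i, P (pgen R i)) -> forall x, P x.
Proof.
move=> P1 PM PV Pgen x; elim/presentedW: x.
elim=> [|[i b] w IHw]; first exact: P1.
rewrite -cat1s -presented_mulE; apply: PM IHw.
case: b (Pgen i) => // /PV.
by rewrite /pgen [X in P X]presented_invE.
Qed.

Lemma presented_ext (G : groupType) (f g : presented R -> G) :
  {morph f : x y / x * y} -> {morph g : x y / x * y} ->
  (forall i, f (pgen R i) = g (pgen R i)) -> f =1 g.
Proof.
move=> fM gM fg; apply: presented_ind => // [|x y|x].
- by rewrite (morph_group1 fM) (morph_group1 gM).
- by rewrite fM gM => -> ->.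
- by rewrite (morph_groupV fM) (morph_groupV gM) => ->.
Qed.

Lemma commute_gen (G : groupType) (f : presented R -> G) :
  {morph f : x y / x * y} ->
  (forall i j, commute (f (pgen R i)) (f (pgen R j))) ->
  forall x y, commute (f x) (f y).
Proof.
move=> fM fC.
have comm_ind x : (forall i, commute x (f (pgen R i))) ->
    forall y, commute x (f y).
  move=> xC; apply: presented_ind => // [|y z Cy Cz|y Cy].
  - by rewrite (morph_group1 fM); apply: commute1.
  - by rewrite fM; apply: commuteM.
  - by rewrite (morph_groupV fM); apply: commuteV.
move=> x; apply: (comm_ind) => j; apply: commute_sym.
by move: x; apply: comm_ind => i; apply: fC.
Qed.

Variables (G : groupType) (f : I -> G).

Definition word_eval (w : word I) : G :=
  foldr (fun l x => (if l.2 then (f l.1)^-1 else f l.1) * x) 1 w.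

Lemma word_eval_cat w1 w2 : word_eval (w1 ++ w2) = word_eval w1 * word_eval w2.
Proof.
elim: w1 => [|l w1 IHw]; first by rewrite mul1g.
by rewrite /= IHw mulgA.
Qed.

(** The hypothesis of von Dyck's theorem: it makes evaluation of words descend to the presented
    group. *)
Definition respects := forall r, r \in R -> word_eval r.1 = word_eval r.2.
Hypothesis fR : respects.

Lemma word_eval_eqv w1 w2 : word_eqv R w1 w2 -> word_eval w1 = word_eval w2.
Proof.
elim=> {w1 w2} [w1 w2 /fR //|i b|//|w1 w2 _ ->//|w1 w2 w3 _ -> _ ->//|].
  by case: b; rewrite /= mulg1 ?mulVg ?mulgV.
by move=> w1 w2 w3 w4 _ eq12 _ eq34; rewrite !word_eval_cat eq12 eq34.
Qed.

Definition hom_lift_fun (x : presented R) : G :=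
  word_eval (repr x).

Lemma hom_lift_pi w : hom_lift_fun (\pi_(presented R)%qT w) = word_eval w.
Proof. exact/word_eval_eqv/Defs.reprP. Qed.

Lemma hom_liftM : {morph hom_lift_fun : x y / x * y}.
Proof.
move=> x y; elim/presentedW: x => x; elim/presentedW: y => y.
by rewrite [_ * _]presented_mulE !hom_lift_pi word_eval_cat.
Qed.

Definition hom_lift : hom (presented R) G := Hom hom_liftM.

Lemma hom_lift_gen i : hom_lift (pgen R i) = f i.
Proof. by rewrite -[LHS]/(hom_lift_fun _) hom_lift_pi /= mulg1. Qed.

End Lift.

Lemma word_eval_pgen (I : choiceType) (R : relations I) (w : word I) :
  word_eval (pgen R) w = \pi_(presented R)%qT w.
Proof.
elim: w => [|[i b] w /= ->] //.
rewrite -[(i, b) :: w]cat1s -presented_mulE.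
by case: b; rewrite //= /pgen [_^-1]presented_invE.
Qed.

Lemma presented_rel (I : choiceType) (R : relations I) : respects R (pgen R).
Proof.
by move=> [w1 w2] Rw; rewrite !word_eval_pgen /=; apply/Defs.piP/WordRel.
Qed.

Arguments hom_lift {I R G} f fR.

Lemma ord1_ind (P : 'I_1 -> Prop) : P (ord 1 0) -> forall i, P i.
Proof. by move=> P0 [[|//] lti]; rewrite (bool_irrelevance lti isT). Qed.

Lemma ord2_ind (P : 'I_2 -> Prop) :
  P (ord 2 0) -> P (ord 2 1) -> forall i, P i.
Proof. by move=> P0 P1 [[|[|//]] lti]; rewrite (bool_irrelevance lti isT). Qed.

Lemma ord3_ind (P : 'I_3 -> Prop) :
  P (ord 3 0) -> P (ord 3 1) -> P (ord 3 2) -> forall i, P i.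
Proof.
by move=> P0 P1 P2 [[|[|[|//]]] lti]; rewrite (bool_irrelevance lti isT).
Qed.

Lemma ord5_ind (P : 'I_5 -> Prop) :
  P (ord 5 0) -> P (ord 5 1) -> P (ord 5 2) -> P (ord 5 3) -> P (ord 5 4) ->
  forall i, P i.
Proof.
move=> P0 P1 P2 P3 P4.
by case=> [[|[|[|[|[|//]]]]] lti]; rewrite (bool_irrelevance lti isT).
Qed.

Section FreeLift.
Variables (k : nat) (G : groupType) (s : seq G).

Lemma free_respects : respects [::] (fun i : 'I_k => nth 1 s i).
Proof. by []. Qed.

(** The list [s] gives the images of the generators; the default [1] matters only if it has fewer
    than [k] entries. *)
Definition free_lift : hom (free_group k) G :=
  hom_lift _ free_respects.

Lemma free_lift_gen i : free_lift (fgen i) = nth 1 s i.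
Proof. exact: hom_lift_gen. Qed.

End FreeLift.

Arguments free_lift k {G} s.

(** * Actions of presented groups *)

Section Actions.
Variables (I : choiceType) (R : relations I) (N : groupType).

Section PresentedAction.
Variables (f : I -> bijection N) (fR : respects R f).
Hypothesis fM : forall i, {morph f i : m n / m * n}.

Definition presented_act (q : presented R) : N -> N := hom_lift f fR q.

Lemma presented_act1q n : presented_act 1 n = n.
Proof. by rewrite /presented_act hom1. Qed.

Lemma presented_actMq q r n :
  presented_act (q * r) n = presented_act q (presented_act r n).
Proof. by rewrite /presented_act homM. Qed.

Lemma presented_actMn q : {morph presented_act q : m n / m * n}.
Proof.
elim/presented_ind: q => [m n|q r IHq IHr m n|q IHq m n|i m n].
- by rewrite !presented_act1q.
- by rewrite !presented_actMq IHr IHq.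
(* Multiplicativity passes to the inverse because it may be tested after applying the injective map
   of [q]. *)
- have act_inj : injective (presented_act q) by apply/can_inj/bij_funK.
  by apply: act_inj; rewrite IHq -!presented_actMq mulgV !presented_act1q.
- by rewrite /presented_act hom_lift_gen fM.
Qed.

Definition presented_action : group_action (presented R) N :=
  GroupAction presented_act1q presented_actMq presented_actMn.

Lemma presented_action_gen i n : presented_action (pgen R i) n = f i n.
Proof. by rewrite -[LHS]/(hom_lift f fR _ n) hom_lift_gen. Qed.

Lemma presented_action_genV i n :
  presented_action (pgen R i)^-1 n = bij_inv (f i) n.
Proof.
by rewrite -[LHS]/(hom_lift f fR _ n) homV hom_lift_gen.
Qed.

End PresentedAction.

Lemma action_equivariant (T : Type) (phi : group_action (presented R) N)
    (psi : hom (presented R) (bijection T)) (h : N -> T) :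
  (forall i n, h (phi (pgen R i) n) = psi (pgen R i) (h n)) ->
  forall q n, h (phi q n) = psi q (h n).
Proof.
move=> phi_gen; elim/presented_ind => [n|q r IHq IHr n|q IHq n|//].
- by rewrite act1q hom1.
- by rewrite actMq IHq IHr homM.
- apply: (can_inj (bij_funK (psi q))).
  by rewrite -IHq -actMq mulgV act1q homV bij_invK.
Qed.

End Actions.

(** * Universal property of semidirect products *)

Section SemidirectTheory.
Variables (Q N : groupType) (phi : group_action Q N).

Definition semidirect_group : groupType := semidirect phi.

Lemma sdl_subproof : {morph (fun n => (n, 1) : semidirect_group) : m n / m * n}.
Proof. by move=> m n; congr pair; rewrite /= ?act1q ?mulg1. Qed.
Lemma sdr_subproof : {morph (fun q => (1, q) : semidirect_group) : q r / q * r}.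
Proof. by move=> q r; congr pair; rewrite /= act_n1 mulg1. Qed.

Definition sdl : hom N semidirect_group := Hom sdl_subproof.
Definition sdr : hom Q semidirect_group := Hom sdr_subproof.

Lemma sdlE n : sdl n = (n, 1). Proof. by []. Qed.
Lemma sdrE q : sdr q = (1, q). Proof. by []. Qed.

Lemma semidirectE (x : semidirect_group) : x = sdl x.1 * sdr x.2.
Proof. by case: x => n q; congr pair; rewrite /= ?act1q ?mulg1 ?mul1g. Qed.

Lemma sdl_act q n : sdl (phi q n) = sdr q * sdl n * (sdr q)^-1.
Proof.
apply: (mulIg (sdr q)); rewrite mulgVK.
by congr pair; rewrite /= ?act1q ?act_n1 ?mulg1 ?mul1g.
Qed.

Lemma semidirect2M : {morph (fun x : semidirect_group => x.2) : x y / x * y}.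
Proof. by []. Qed.

Section SemidirectLift.
Variables (G : groupType).
Variables (f : hom N G) (g : hom Q G).

Definition compatible := forall q n, f (phi q n) = g q * f n * (g q)^-1.

Hypothesis fg : compatible.

Lemma semidirect_lift_subproof :
  {morph (fun x : semidirect_group => f x.1 * g x.2) : x y / x * y}.
Proof. by move=> [n q] [m r]; rewrite /= !homM fg !mulgA mulgVK. Qed.

Definition semidirect_lift : hom semidirect_group G :=
  Hom semidirect_lift_subproof.

Lemma semidirect_lift_sdl n : semidirect_lift (sdl n) = f n.
Proof. by rewrite -[LHS]/(f n * g 1) hom1 mulg1. Qed.

Lemma semidirect_lift_sdr q : semidirect_lift (sdr q) = g q.
Proof. by rewrite -[LHS]/(f 1 * g q) hom1 mul1g. Qed.

End SemidirectLift.
End SemidirectTheory.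

Arguments sdl {Q N} phi.
Arguments sdr {Q N} phi.
Arguments semidirect_lift {Q N phi G f g} fg.

Lemma compatible_gen (I J : choiceType) (R : relations I) (S : relations J)
    (G : groupType) (phi : group_action (presented R) (presented S))
    (f : hom (presented S) G)
    (g : hom (presented R) G) :
  (forall i j, f (phi (pgen R i) (pgen S j)) =
               g (pgen R i) * f (pgen S j) * (g (pgen R i))^-1) ->
  compatible phi f g.
Proof.
move=> fg; elim/presented_ind => [n|q r IHq IHr n|q IHq n|i].
- by rewrite act1q hom1 mul1g divg1.
- by rewrite actMq IHq IHr homM invgM !mulgA.
- rewrite -[n in RHS](act1q phi) -(mulgV q) actMq IHq homV invgK.
  by rewrite !mulgA mulVg mul1g mulgVK.
- apply: presented_ext => [m n|m n|//]; first by rewrite actMn homM.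
  by rewrite homM !mulgA mulgVK.
Qed.

(** * Derived series *)

Section DerivedTheory.
Variable G : groupType.
Local Notation D := (@derived_series G).

Lemma derived1 n : 1 \in D n.
Proof. by case: (derived_series_group_closed G n). Qed.

Lemma derivedM n x y : x \in D n -> y \in D n -> x * y \in D n.
Proof.
exact: (group_closedM (derived_series_group_closed G n)).
Qed.

Lemma derivedV n x : x \in D n -> x^-1 \in D n.
Proof.
exact: (group_closedV (derived_series_group_closed G n)).
Qed.

Lemma derivedR n x y : x \in D n -> y \in D n -> [~ x, y] \in D n.+1.
Proof.
move=> Dx Dy; apply/asboolP=> H _; apply.
by apply/asboolP; exists x, y.
Qed.

Lemma derivedS_min n (P : G -> Prop) :
  P 1 -> (forall x y, P x -> P y -> P (x / y)) ->
  (forall x y, x \in D n -> y \in D n -> P [~ x, y]) ->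
  forall x, x \in D n.+1 -> P x.
Proof.
move=> P1 PF PR x /asboolP /(_ (fun y => `[< P y >])) DP; apply/asboolP/DP.
  by split=> [|y z /asboolP Py /asboolP Pz]; apply/asboolP; auto.
by move=> _ /asboolP [y [z [Dy Dz ->]]]; apply/asboolP/PR.
Qed.

End DerivedTheory.

(** Used with [m = 0] for plain functoriality, and with [m = 1] to gain one step from the fact that
    <u, v> lies in the derived group of B3. *)
Lemma derived_image (G H : groupType) (f : hom G H) m :
  (forall x, f x \in derived_series m) ->
  forall n x, x \in derived_series n -> f x \in derived_series (n + m).
Proof.
move=> fD; elim=> [|n IHn] x; first by rewrite fD.
move: x; apply: derivedS_min => [|x y Dx Dy|x y Dx Dy].
- by rewrite hom1 derived1.
- by rewrite homF derivedM ?derivedV.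
- by rewrite homR derivedR ?IHn.
Qed.

Lemma derived_hom (G1 G2 : groupType) (f : hom G1 G2) n z :
  z \in derived_series n -> f z \in derived_series n.
Proof. by move=> Dz; rewrite -[n]addn0 derived_image. Qed.

Lemma derivedJ (G : groupType) n (x y : G) :
  x \in derived_series n -> x ^ y \in derived_series n.
Proof.
exact: (@derived_hom _ _ (Hom (fun x1 x2 => conjMg x1 x2 y))).
Qed.

Lemma derived_isomorphic (G H : groupType) (f : hom H G) n :
  injective f -> (forall x, x \in derived_series n <-> exists y, x = f y) ->
  isomorphic (derived_group G n) H.
Proof.
move=> f_inj fD.
have f'P (x : derived_group G n) : {y | val x = f y}.
  by apply/cid/fD; apply: (valP x).
pose g x := sval (f'P x); have fg x : f (g x) = val x.
  by rewrite /g; case: (f'P x).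
have gM : {morph g : x y / x * y}.
  by move=> x y; apply: f_inj; rewrite homM !fg gmulfM.
pose gMix := isMultiplicative.Build (derived_group G n) H g gM.
exists (HB.pack g gMix : {multiplicative derived_group G n -> H}).
have fD' y : f y \in derived_series n by apply/fD; exists y.
exists (fun y => Sub (f y) (fD' y)) => [x|y] /=.
  by apply: val_inj; rewrite /= fg.
by apply: f_inj; rewrite fg.
Qed.

(** * The braid groups as semidirect products *)

Definition braid3_relations : relations 'I_2 :=
  let x := (ord 2 0, false) in
  let y := (ord 2 1, false) in
  [:: ([:: y; x; y], [:: x; y; x])].

Definition braid_group3 : groupType := presented braid3_relations.

Local Notation B3 := braid_group3.
Local Notation B4 := braid_group4.
Local Notation x := (pgen braid3_relations (ord 2 0)).
Local Notation y := (pgen braid3_relations (ord 2 1)).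
Local Notation s1 := (pgen braid4_relations (ord 3 0)).
Local Notation s2 := (pgen braid4_relations (ord 3 1)).
Local Notation s3 := (pgen braid4_relations (ord 3 2)).
Local Notation a := (fgen (ord 2 0)).
Local Notation b := (fgen (ord 2 1)).
Local Notation u := (fgen (ord 2 0)).
Local Notation v := (fgen (ord 2 1)).

Lemma free2_ext (G : groupType) (f g : free_group 2 -> G) :
  {morph f : m n / m * n} -> {morph g : m n / m * n} ->
  f a = g a -> f b = g b -> f =1 g.
Proof. by move=> fM gM fa fb; apply: presented_ext => //; apply: ord2_ind. Qed.

Local Ltac hom_morph := by move=> ? ?; rewrite /= !homM.
Local Ltac lift_eval :=
  rewrite /= ?(homM, homV, free_lift_gen) /= ?expgS ?gnorm.

Lemma braid3_rel : y * x * y = x * y * x :> B3.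
Proof.
have /= := @presented_rel _ braid3_relations _ (mem_head _ _).
by rewrite !mulg1 !mulgA.
Qed.

Lemma braid4_rel :
  [/\ s1 * s3 = s3 * s1 :> B4, s1 * s2 * s1 = s2 * s1 * s2 :> B4
    & s2 * s3 * s2 = s3 * s2 * s3 :> B4].
Proof.
have rel i : nth ([::], [::]) braid4_relations i \in braid4_relations ->
  word_eval (pgen braid4_relations) (nth ([::], [::]) braid4_relations i).1 =
  word_eval (pgen braid4_relations) (nth ([::], [::]) braid4_relations i).2.
  exact: presented_rel.
move: (rel 0) (rel 1%N) (rel 2); rewrite /= !mulg1 !mulgA !inE !eqxx ?orbT.
by move=> h1 h2 h3; split; [apply: h1 | apply: h2 | apply: h3].
Qed.

(** * The action of B3 on the free group on a and b *)

Section FreeAction.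

(** [T] and [S] are the conjugations by s1 and s2 on a = s3 s1^-1 and b = s2 a s2^-1, as
    [braid_conj] confirms; [T'] and [S'] are their inverses. *)
Let T := free_lift 2 [:: a; a^-1 * b].
Let T' := free_lift 2 [:: a; a * b].
Let S := free_lift 2 [:: b; b * a^-1 * b].
Let S' := free_lift 2 [:: a * b^-1 * a; a].

Lemma free_TK : cancel T T'.
Proof. by apply: free2_ext; [hom_morph|done|lift_eval|lift_eval]. Qed.
Lemma free_T'K : cancel T' T.
Proof. by apply: free2_ext; [hom_morph|done|lift_eval|lift_eval]. Qed.
Lemma free_SK : cancel S S'.
Proof. by apply: free2_ext; [hom_morph|done|lift_eval|lift_eval]. Qed.
Lemma free_S'K : cancel S' S.
Proof. by apply: free2_ext; [hom_morph|done|lift_eval|lift_eval]. Qed.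

Let gens : seq (bijection (free_group 2)) :=
  [:: Bijection free_TK free_T'K; Bijection free_SK free_S'K].

Lemma braid3_respects : respects braid3_relations (fun i => nth 1 gens i).
Proof.
move=> r; rewrite inE => /eqP ->; apply: bij_ext.
by apply: free2_ext; [hom_morph|hom_morph|lift_eval|lift_eval].
Qed.

Lemma braid3_gensM (i : 'I_2) : {morph nth 1 gens (nat_of_ord i) : m n / m * n}.
Proof. by move: i; apply: ord2_ind => m n; exact: homM. Qed.

Definition braid3_action : group_action B3 (free_group 2) :=
  presented_action braid3_respects braid3_gensM.

Local Notation phi := braid3_action.

Lemma braid3_actionE :
  [/\ phi x a = a, phi x b = a^-1 * b, phi y a = b & phi y b = b * a^-1 * b].
Proof.
by split; rewrite presented_action_gen; lift_eval.
Qed.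

Lemma braid3_actionVE :
  [/\ phi x^-1 a = a, phi x^-1 b = a * b, phi y^-1 a = a * b^-1 * a
    & phi y^-1 b = a].
Proof.
by split; rewrite presented_action_genV; lift_eval.
Qed.

End FreeAction.

Local Notation phi := braid3_action.
Local Notation t := (fgen (ord 1 0)).

(** * B3 as a semidirect product *)

Section CyclicAction.

(** Conjugation by x on u = y x^-1 and v = x u x^-1; the value at v encodes the braid relation. *)
Let W := free_lift 2 [:: v; u^-1 * v].
Let W' := free_lift 2 [:: u * v^-1; u].

Lemma cyclic_WK : cancel W W'.
Proof. by apply: free2_ext; [hom_morph|done|lift_eval|lift_eval]. Qed.
Lemma cyclic_W'K : cancel W' W.
Proof. by apply: free2_ext; [hom_morph|done|lift_eval|lift_eval]. Qed.

Lemma cyclic_respects :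
  respects (I := 'I_1) [::]
    (fun=> Bijection cyclic_WK cyclic_W'K : bijection _).
Proof. by []. Qed.

Definition cyclic_action : group_action (free_group 1) (free_group 2) :=
  presented_action (I := 'I_1) cyclic_respects (fun=> @homM _ _ W).

Lemma cyclic_actionE :
  cyclic_action t u = v /\ cyclic_action t v = u^-1 * v.
Proof. by split; rewrite presented_action_gen; lift_eval. Qed.

End CyclicAction.

Lemma braid3_split_respects :
  respects braid3_relations
    (fun i => nth 1 [:: sdr cyclic_action t; sdl cyclic_action u * sdr _ t] i).
Proof.
move=> r; rewrite inE => /eqP -> /=; case: cyclic_actionE => tu tv.
congr pair; last by rewrite /= !gnorm.
by rewrite /= !(actMn, actMq, act1q, act_n1, tu, tv, gnorm).
Qed.

Definition braid3_split : hom B3 (semidirect_group cyclic_action) :=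
  hom_lift _ braid3_split_respects.


Lemma braid3_splitE :
  braid3_split x = sdr _ t /\ braid3_split y = sdl _ u * sdr _ t.
Proof. by rewrite /braid3_split /= !hom_lift_gen. Qed.

Definition braid3_embed : hom (free_group 2) B3 :=
  free_lift 2 [:: y * x^-1; x * y * x^-1 * x^-1].


Local Notation iota := braid3_embed.

Lemma braid3_embedE : iota u = y * x^-1 /\ iota v = x * y * x^-1 * x^-1.
Proof. by rewrite /braid3_embed !free_lift_gen. Qed.

Lemma braid3_embed_compatible :
  compatible cyclic_action braid3_embed (free_lift 1 [:: x]).
Proof.
apply: compatible_gen => i j; move: i j; apply: ord1_ind.
have [tu tv] := cyclic_actionE.
apply: ord2_ind; first by rewrite tu; lift_eval.
rewrite tv; lift_eval.
(* The braid relation in a form which, multiplied by x on the left and by x^-2 on the right, reads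
   u^-1 v = x v x^-1. *)
have e : y^-1 * x * y = x * y * x^-1.
  by apply: (mulgI y); apply: (mulIg x); rewrite !gnorm braid3_rel.
by have := congr1 (fun z => x * z * x^-1 * x^-1) e; rewrite !gnorm.
Qed.

Lemma braid3_split_embed q : braid3_split (iota q) = sdl _ q.
Proof.
have [[tu tv] [iu iv]] := (cyclic_actionE, braid3_embedE).
have [sx sy] := braid3_splitE.
move: q; apply: free2_ext; [hom_morph|hom_morph| |].
  by rewrite iu homM homV sx sy mulgK.
by rewrite iv !homM !homV sx sy !mulgA mulgK -sdl_act tu.
Qed.

Lemma braid3_embed_inj : injective iota.
Proof.
by move=> q r /(congr1 braid3_split); rewrite !braid3_split_embed => - [].
Qed.

Lemma braid3_splitK :
  cancel braid3_split (semidirect_lift braid3_embed_compatible).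
Proof.
have [sx sy] := braid3_splitE.
apply: presented_ext; [hom_morph|done|apply: ord2_ind].
  by rewrite sx semidirect_lift_sdr free_lift_gen.
rewrite sy homM [X in X * _]semidirect_lift_sdl semidirect_lift_sdr.
by rewrite !free_lift_gen /= mulgVK.
Qed.

(** One derivation removes the cyclic coordinate; from then on commutators are taken inside <u, v>,
    one step behind those of B3. *)
Lemma derived_braid3_split n z : z \in derived_series n.+1 ->
  exists2 q, q \in derived_series n & braid3_split z = sdl _ q.
Proof.
elim: n z => [|n IHn]; apply: derivedS_min.
- by exists 1; rewrite ?derived1 // !hom1.
- move=> z z' [q Dq zE] [q' Dq' zE']; exists (q / q').
    by rewrite derivedM ?derivedV.
  by rewrite !homF zE zE'.
- move=> z z' _ _; exists (braid3_split [~ z, z']).1 => //.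
  rewrite [LHS]semidirectE -[RHS]mulg1; congr (_ * _).
  (* [p] is the exponent sum: both generators go to [t], so its image is commutative and it kills
     commutators. *)
  pose p z := (braid3_split z).2; have pM : {morph p : z z' / z * z'}.
    by move=> ? ?; rewrite /p homM.
  have pC : commute (p z) (p z').
    apply: commute_gen => // i j; have pt k : p (pgen _ k) = t.
      have [sx sy] := braid3_splitE.
      by move: k; apply: ord2_ind; rewrite /p ?sx ?sy //= mul1g.
    by rewrite !pt.
  congr pair; rewrite -/(p _).
  by rewrite commgEl !pM !(morph_groupV pM) pC !gnorm.
- by exists 1; rewrite ?derived1 // !hom1.
- move=> z z' [q Dq zE] [q' Dq' zE']; exists (q / q').
    by rewrite derivedM ?derivedV.
  by rewrite !homF zE zE'.
- move=> z z' /IHn [q Dq zE] /IHn [q' Dq' zE']; exists [~ q, q'].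
    exact: derivedR.
  by rewrite !homR zE zE'.
Qed.

Lemma derived_braid3 n z : z \in derived_series n.+1 ->
  exists2 q, q \in derived_series n & z = iota q.
Proof.
move=> /derived_braid3_split [q Dq zE]; exists q => //.
by rewrite -[z]braid3_splitK zE semidirect_lift_sdl.
Qed.

Lemma braid_conj (G : groupType) (g1 g2 g3 : G) :
    g1 * g3 = g3 * g1 -> g1 * g2 * g1 = g2 * g1 * g2 ->
    g2 * g3 * g2 = g3 * g2 * g3 ->
  let A := g3 / g1 in let B := g2 * A / g2 in
  [/\ g1 * A / g1 = A, g1 * B / g1 = A^-1 * B & g2 * B / g2 = B * A^-1 * B].
Proof.
move=> c13 r12 r23 A B; rewrite /B /A.
have e12 : g1^-1 / g2 * g1 = g2 / g1 / g2.
  apply: (mulgI g1); apply: (mulIg g2); rewrite !gnorm.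
  by apply: (mulgI g2); rewrite !gnorm -r12 !gnorm.
have e23 : g3^-1 * g2 * g3 = g2 * g3 / g2.
  by apply: (mulgI g3); apply: (mulIg g2); rewrite !gnorm -r23.
have e13 : g1^-1 * g3 = g3 / g1.
  by apply: (mulgI g1); apply: (mulIg g1); rewrite !gnorm c13.
split; first by rewrite !gnorm c13 !gnorm.
- rewrite !gnorm.
  (* A relation is applied inside a word by first multiplying it by the factors that surround it
     there; the third formula is reached in the same way. *)
  have := congr1 (fun w => g1 * w / g1 / g2) e23; rewrite !gnorm => ->.
  have := congr1 (fun w => g1 * g2 * g3 * w^-1) r12.
  by rewrite !gnorm.
- rewrite !gnorm.
  have := congr1 (fun w => g2 * g3 * w * g3^-1 * g2 * g3 / g1 / g2) e12.
  rewrite !gnorm => ->.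
  have := congr1 (fun w => g2 * g3 * g2 / g1 / g2 * w / g1 / g2) e23.
  rewrite !gnorm => ->.
  have := congr1 (fun w => g2 * g3 * g2 * w / g2 / g1 / g2) e13.
  rewrite !gnorm => ->.
  have := congr1 (fun w => g2 * w / g1 / g2 / g1 / g2) r23.
  rewrite !gnorm => <-.
  have := congr1 (fun w => g2 * g2 * g3 * g2 * w^-1 / g2) r12.
  by rewrite !gnorm.
Qed.

(** * B4 as a semidirect product *)

Local Notation G := (semidirect_group braid3_action).
Local Notation inl := (sdl braid3_action).
Local Notation inr := (sdr braid3_action).

Lemma braid4_split_respects :
  respects braid4_relations
    (fun i => nth 1 [:: inr x; inr y; inl a * inr x] i).
Proof.
have [xa xb ya yb] := braid3_actionE.
move=> r; rewrite !inE => /or3P [] /eqP -> /=; rewrite ?sdlE !sdrE.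
all: congr pair.
all: rewrite /= ?(actMn, actMq, act1q, act_n1, xa, ya, xb) ?gnorm //.
all: by rewrite braid3_rel.
Qed.

Definition braid4_split : hom B4 G := hom_lift _ braid4_split_respects.

Lemma braid4_splitE :
  [/\ braid4_split s1 = inr x, braid4_split s2 = inr y
    & braid4_split s3 = inl a * inr x].
Proof. by rewrite /braid4_split !hom_lift_gen. Qed.

Definition free_to_braid4 : hom (free_group 2) B4 :=
  free_lift 2 [:: s3 / s1; s2 * (s3 / s1) / s2].

Lemma free_to_braid4E :
  free_to_braid4 a = s3 / s1 /\ free_to_braid4 b = s2 * (s3 / s1) / s2.
Proof. by rewrite /free_to_braid4 !free_lift_gen. Qed.

Lemma braid3_to_braid4_respects :
  respects braid3_relations (fun i => nth 1 [:: s1 : B4; s2] i).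
Proof.
have [_ r12 _] := braid4_rel.
by move=> r; rewrite inE => /eqP -> /=; rewrite !mulg1 !mulgA -r12.
Qed.

Definition braid3_to_braid4 : hom B3 B4 := hom_lift _ braid3_to_braid4_respects.

Lemma braid3_to_braid4E :
  braid3_to_braid4 x = s1 /\ braid3_to_braid4 y = s2.
Proof. by rewrite /braid3_to_braid4 !hom_lift_gen. Qed.

Lemma braid4_join_compatible : compatible phi free_to_braid4 braid3_to_braid4.
Proof.
have [[ga gb] [gx gy]] := (free_to_braid4E, braid3_to_braid4E).
have [c13 r12 r23] := braid4_rel; have [xa xb ya yb] := braid3_actionE.
have [e1 e2 e3] := braid_conj c13 r12 r23.
apply: compatible_gen => i j; move: i j.
apply: ord2_ind; apply: ord2_ind; rewrite ?(gx, gy).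
- by rewrite xa ga e1.
- by rewrite xb homM homV ga gb e2.
- by rewrite ya ga gb.
- by rewrite yb !homM homV ga gb e3.
Qed.

Definition braid4_join : hom G B4 := semidirect_lift braid4_join_compatible.

Lemma braid4_splitK : cancel braid4_split braid4_join.
Proof.
have [[ga gb] [gx gy]] := (free_to_braid4E, braid3_to_braid4E).
have [sx sy sz] := braid4_splitE.
apply: presented_ext; [hom_morph|done|apply: ord3_ind].
- by rewrite sx [LHS]semidirect_lift_sdr gx.
- by rewrite sy [LHS]semidirect_lift_sdr gy.
- rewrite sz homM [X in X * _]semidirect_lift_sdl.
  by rewrite [X in _ * X]semidirect_lift_sdr ga gx mulgVK.
Qed.

Lemma braid4_joinK : cancel braid4_join braid4_split.
Proof.
have [[ga gb] [gx gy]] := (free_to_braid4E, braid3_to_braid4E).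
have [sx sy sz] := braid4_splitE; have [_ _ ya _] := braid3_actionE.
have splitl n : braid4_split (free_to_braid4 n) = inl n.
  have split_a : braid4_split (free_to_braid4 a) = inl a.
    by rewrite ga homM homV sz sx mulgK.
  move: n; apply: free2_ext; [hom_morph|hom_morph|exact: split_a|].
  by rewrite gb -ga !homM homV split_a sy -sdl_act ya.
have splitr q : braid4_split (braid3_to_braid4 q) = inr q.
  move: q; apply: presented_ext; [hom_morph|hom_morph|apply: ord2_ind].
    by rewrite gx sx.
  by rewrite gy sy.
move=> z; rewrite -[braid4_join z]/(free_to_braid4 z.1 * braid3_to_braid4 z.2).
by rewrite homM splitl splitr -semidirectE.
Qed.

(** * The kernel of the free group of rank 2 onto the Klein four-group *)

(** The group Z/2: [bool] under exclusive or, with [false] as identity and every element its own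
    inverse. *)
HB.instance Definition _ :=
  isGroup.Build bool addbA addFb addbF addbb addbb.

Local Notation klein := (bool * bool)%type.

Definition parity : hom (free_group 2) klein :=
  free_lift 2 [:: (true, false); (false, true)].

Lemma parityE : parity a = (true, false) /\ parity b = (false, true).
Proof. by rewrite /parity !free_lift_gen. Qed.

Section ParityAction.

(** Modulo 2, x fixes a and sends b to a + b, while y exchanges a and b; these involutions generate
    GL_2(F_2), a symmetric group of degree 3. *)
Let shear (t : klein) : klein := (t.1 (+) t.2, t.2).
Let swap (t : klein) : klein := (t.2, t.1).

Lemma shearK : involutive shear. Proof. by case=> [[] []]. Qed.
Lemma swapK : involutive swap. Proof. by case=> [[] []]. Qed.

Let gens := [:: Bijection shearK shearK; Bijection swapK swapK].

Lemma parity_respects : respects braid3_relations (fun i => nth 1 gens i).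
Proof. by move=> r; rewrite inE => /eqP ->; apply: bij_ext => -[[] []]. Qed.

Definition parity_action : hom B3 (bijection klein) :=
  hom_lift _ parity_respects.

Lemma parity_act q n : parity (phi q n) = parity_action q (parity n).
Proof.
have [xa xb ya yb] := braid3_actionE; have [pa pb] := parityE.
move: q n; apply: action_equivariant; apply: ord2_ind; rewrite hom_lift_gen.
- apply: free2_ext => [m n|m n||]; rewrite ?actMn ?homM //.
  + by rewrite /shear /=; case: (parity m) (parity n) => [[] []] [[] []].
  + by rewrite xa pa.
  + by rewrite xb homM homV pa pb.
- apply: free2_ext => [m n|m n||]; rewrite ?actMn ?homM //.
  + by rewrite ya pa pb.
  + by rewrite yb !homM homV pa pb.
Qed.

Lemma parity_action1 q : parity_action q 1 = 1.
Proof. by rewrite -[1 in LHS](hom1 parity) -parity_act act_n1 hom1. Qed.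

(** Each of u and v acts as a product of the two involutions, in opposite orders: these are mutually
    inverse 3-cycles, so <u, v> acts through a commutative group. *)
Lemma parity_action_derived q :
  q \in derived_series 1 -> parity_action (iota q) = 1.
Proof.
move: q; apply: derivedS_min => [|q r|q r _ _]; first by rewrite !hom1.
  by move=> qE rE; rewrite !homF qE rE divg1.
have [iu iv] := braid3_embedE.
have comm_qr : commute (parity_action (iota q)) (parity_action (iota r)).
  move: q r; apply: commute_gen; first by hom_morph.
  suff uv : commute (parity_action (iota u)) (parity_action (iota v)).
    by apply: ord2_ind; apply: ord2_ind => //; apply: commute_sym.
  rewrite iu iv !homM !homV !hom_lift_gen /=.
  by apply: bij_ext => -[[] []].
by rewrite !homR; apply/eqP/commgP.
Qed.

End ParityAction.

Local Notation z1 := (fgen (ord 5 0)).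
Local Notation z2 := (fgen (ord 5 1)).
Local Notation z3 := (fgen (ord 5 2)).
Local Notation z4 := (fgen (ord 5 3)).
Local Notation z5 := (fgen (ord 5 4)).

Definition even_embed : hom (free_group 5) (free_group 2) :=
  free_lift 5 [:: a * a; b * b; a * b * a * b; b * a * a / b; a * b * b / a].

Lemma even_embedE :
  [/\ even_embed z1 = a * a, even_embed z2 = b * b,
      even_embed z3 = a * b * a * b, even_embed z4 = b * a * a / b
    & even_embed z5 = a * b * b / a].
Proof. by rewrite /even_embed !free_lift_gen. Qed.

Lemma parity_even_embed x : parity (even_embed x) = 1.
Proof.
have [e1 e2 e3 e4 e5] := even_embedE; have [pa pb] := parityE.
move: x; apply: (presented_ext (g := fun=> 1)); first by hom_morph.
  by move=> ? ?; rewrite mulg1.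
by apply: ord5_ind; rewrite -/(fgen _) ?e1 ?e2 ?e3 ?e4 ?e5 !homM ?homV ?pa ?pb.
Qed.

(** * Reidemeister-Schreier rewriting *)

Section Schreier.

Definition coset_rep (t : klein) : free_group 2 :=
  (if t.1 then a else 1) * (if t.2 then b else 1).

Lemma parity_coset_rep t : parity (coset_rep t) = t.
Proof.
have [pa pb] := parityE.
by case: t => [[] []]; rewrite homM /= ?hom1 ?pa ?pb.
Qed.

Section CosetBijection.
Variables (m : klein) (s : klein -> free_group 5).

(** Bijective for every [s]: [m] permutes the cosets, and each fibre is translated on the left. *)
Let coset_fun (p : klein * free_group 5) : klein * free_group 5 :=
  (m * p.1, s p.1 * p.2).
Let coset_inv (p : klein * free_group 5) : klein * free_group 5 :=
  (m^-1 * p.1, (s (m^-1 * p.1))^-1 * p.2).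

Lemma coset_funK : cancel coset_fun coset_inv.
Proof. by case=> t x; rewrite /coset_fun /coset_inv /= !mulKg. Qed.
Lemma coset_invK : cancel coset_inv coset_fun.
Proof. by case=> t x; rewrite /coset_fun /coset_inv /= mulVKg mulVKg. Qed.

Definition coset_bij := Bijection coset_funK coset_invK.
End CosetBijection.

(** The Schreier elements r'^-1 a r and r'^-1 b r written in the z_i, where r is the representative
    of [t] and r' that of the coset of a r or b r. For instance a (a b) = b (b^-1 a^2 b), and b^-1
    a^2 b = z2^-1 z4 z2. *)
Definition schreier_a (t : klein) : free_group 5 :=
  if t.1 then if t.2 then z2^-1 * z4 * z2 else z1 else 1.
Definition schreier_b (t : klein) : free_group 5 :=
  if t.1 then if t.2 then z1^-1 * z3 else z3^-1 * z5 * z1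
  else if t.2 then z2 else 1.

(* The pair (t, x) stands for the element [coset_rep t * even_embed x], on
   which the free group acts by left translation. *)
Definition schreier : hom (free_group 2) (bijection (klein * free_group 5)) :=
  free_lift 2 [:: coset_bij (true, false) schreier_a;
                  coset_bij (false, true) schreier_b].

Lemma schreierE :
  schreier a = coset_bij (true, false) schreier_a /\
  schreier b = coset_bij (false, true) schreier_b.
Proof. by rewrite /schreier !free_lift_gen. Qed.

Let value (p : klein * free_group 5) := coset_rep p.1 * even_embed p.2.

Lemma schreier_value n p : value (schreier n p) = n * value p.
Proof.
have [sa sb] := schreierE; have [e1 e2 e3 e4 e5] := even_embedE.
move: n p; apply: presented_ind => [p|m n IHm IHn p|n IHn p|].
- by rewrite hom1 mul1g.
- by rewrite homM [LHS]IHm IHn mulgA.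
- by apply: (mulgI n); rewrite mulVKg -IHn homV bij_invK.
apply: ord2_ind => -[t x]; rewrite -/(fgen _) ?sa ?sb /value /=.
  by case: t => [[] []]; rewrite /coset_rep /schreier_a /= !homM ?homV
    ?hom1 ?e1 ?e2 ?e3 ?e4 ?e5 !gnorm.
by case: t => [[] []]; rewrite /coset_rep /schreier_b /= !homM ?homV
  ?hom1 ?e1 ?e2 ?e3 ?e4 ?e5 !gnorm.
Qed.

(** Traced through the cosets, the word of each z_i returns to the trivial coset having multiplied
    the label by z_i. As [x] can be recovered from this, the z_i are free. *)
Lemma schreier_even x w : schreier (even_embed x) (1, w) = (1, x * w).
Proof.
have [sa sb] := schreierE; have [e1 e2 e3 e4 e5] := even_embedE.
move: x w; apply: presented_ind => [w|x x' IHx IHx' w|x IHx w|].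
- by rewrite !hom1 mul1g.
- by rewrite !homM [LHS]/= IHx' IHx mulgA.
- apply: (can_inj (bij_funK (schreier (even_embed x)))).
  by rewrite IHx mulVKg !homV bij_invK.
apply: ord5_ind => w; rewrite -/(fgen _) ?e1 ?e2 ?e3 ?e4 ?e5.
all: by rewrite !homM ?homV ?sa ?sb; congr pair;
  rewrite /= /schreier_a /schreier_b /= ?gnorm.
Qed.

Definition even_part (n : free_group 2) : free_group 5 := (schreier n (1, 1)).2.

Lemma even_embedK : cancel even_embed even_part.
Proof. by move=> x; rewrite /even_part schreier_even mulg1. Qed.

(** Translation by [n] moves the base point, of value 1, to a point of value [n]; trivial parity
    places that point in the trivial coset, where the value is the image of the label. *)
Lemma even_partK n : parity n = 1 -> even_embed (even_part n) = n.
Proof.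
have nE : value (schreier n (1, 1)) = n.
  rewrite schreier_value -[value (1, 1)]/(1 * 1 * even_embed 1).
  by rewrite hom1 !mulg1.
have: parity (value (schreier n (1, 1))) = (schreier n (1, 1)).1.
  by rewrite homM parity_coset_rep parity_even_embed mulg1.
rewrite nE => -> n1; rewrite -[RHS]nE /value n1.
by rewrite -[coset_rep 1]/(1 * 1) !mul1g.
Qed.

End Schreier.

(** * The action of <u, v> on the kernel *)

Lemma braid3_act_embed :
  [/\ phi (iota u) a = b, phi (iota u) b = b * b * a^-1 * b,
      phi (iota v) a = a^-1 * b
    & phi (iota v) b = a^-1 * b * a^-1 * b * a^-1 * b * a^-1 * a^-1 * b].
Proof.
have [[xa xb ya yb] [xVa xVb yVa yVb]] := (braid3_actionE, braid3_actionVE).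
have [iu iv] := braid3_embedE; rewrite iu iv.
by split; rewrite ?(actMq, actMn, (morph_groupV (actMn phi _)), xa, xb, ya,
  yb, xVa, xVb, yVa, yVb); rewrite ?gnorm.
Qed.

Lemma even_embed_inj : injective even_embed.
Proof. exact: can_inj even_embedK. Qed.

Definition even_act (q : free_group 2) (n : free_group 5) : free_group 5 :=
  even_part (phi (iota q) (even_embed n)).

(** The kernel of [parity] is stable because B3 acts compatibly on the Klein four-group and fixes
    its identity. *)
Lemma even_actE q n : even_embed (even_act q n) = phi (iota q) (even_embed n).
Proof.
by apply: even_partK; rewrite parity_act parity_even_embed parity_action1.
Qed.

Lemma even_act1q n : even_act 1 n = n.
Proof. by apply: even_embed_inj; rewrite even_actE hom1 act1q. Qed.

Lemma even_actMq q r n : even_act (q * r) n = even_act q (even_act r n).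
Proof. by apply: even_embed_inj; rewrite !even_actE homM actMq. Qed.

Lemma even_actMn q : {morph even_act q : m n / m * n}.
Proof.
by move=> m n; apply: even_embed_inj; rewrite !(even_actE, homM) actMn.
Qed.

Definition even_action : group_action (free_group 2) (free_group 5) :=
  GroupAction even_act1q even_actMq even_actMn.

Lemma even_actionE q n :
  even_embed (even_action q n) = phi (iota q) (even_embed n).
Proof. exact: even_actE. Qed.

(** By injectivity of [even_embed], each formula becomes an identity between words in a and b. *)
Lemma even_action_u :
  [/\ even_action u z1 = z2,
      even_action u z2 = z2 * z1^-1 * z5 * z3 * z2^-1 * z4^-1 * z2,
      even_action u z3 = z2 ^+ 2 * z3^-1 * z5 ^+ 2 * z3 * z2^-1 * z4^-1 * z2,
      even_action u z4 = z2 * z1^-1 * z5 * z1 * z2^-1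
    & even_action u z5 = z2 ^+ 2 * z3^-1 * z5 ^+ 2].
Proof.
have [ua ub _ _] := braid3_act_embed; have [e1 e2 e3 e4 e5] := even_embedE.
split; apply: even_embed_inj; rewrite even_actionE ?expg2 ?(homM, homV);
  rewrite ?(e1, e2, e3, e4, e5);
  rewrite ?(actMn, (morph_groupV (actMn phi _)), ua, ub);
  by rewrite ?gnorm.
Qed.

Lemma even_action_v :
  let w1 := z1^-1 * z3 * z2^-1 * z4^-1 * z2 in
  [/\ even_action v z1 = w1,
      even_action v z2 = w1 ^+ 2 * z3^-1 * z5 * z2 * z3^-1 * z5 * z4^-1 * z2,
      even_action v z3 = w1 ^+ 2 * z1^-1 * (z2 * z3^-1 * z5) ^+ 2 * z4^-1 * z2,
      even_action v z4 = w1 ^+ 2 * z3^-1 * z5 * z2 * w1 ^- 2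
    & even_action v z5 = w1 ^+ 2 * z1^-1 * (z2 * z3^-1 * z5) ^+ 2].
Proof.
move=> w1; have [_ _ va vb] := braid3_act_embed.
have [e1 e2 e3 e4 e5] := even_embedE.
(* [w1] is the square of a^-1 b, the image of a under v. *)
have ew1 : even_embed w1 = a^-1 * b * a^-1 * b.
  by rewrite !(homM, homV) e1 e2 e3 e4 ?gnorm.
split; apply: even_embed_inj; rewrite even_actionE ?expg2 ?(homM, homV) ?ew1;
  rewrite ?(e1, e2, e3, e4, e5);
  rewrite ?(actMn, (morph_groupV (actMn phi _)), va, vb);
  by rewrite ?gnorm.
Qed.

(** * The third derived group *)

Lemma braid3_embed_derived1 q : iota q \in derived_series 1.
Proof.
have [iu iv] := braid3_embedE.
have Du : iota u \in derived_series 1.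
  (* Conjugation by x y takes x to y, so y x^-1 is a commutator. *)
  have -> : iota u = [~ (x * y)^-1, x^-1].
    by rewrite iu commgEl conjgE !gnorm -braid3_rel !gnorm.
  exact: derivedR.
elim/presented_ind: q => [|q r Dq Dr|q Dq|].
- by rewrite hom1 derived1.
- by rewrite homM derivedM.
- by rewrite homV derivedV.
apply: ord2_ind => //; rewrite -/(fgen _).
have -> : iota v = iota u ^ x^-1 by rewrite iu iv conjgE !gnorm.
exact: derivedJ.
Qed.

Lemma braid3_embed_derived n q :
  q \in derived_series n -> iota q \in derived_series n.+1.
Proof.
move=> Dq; rewrite -[n.+1]addn1.
exact: derived_image braid3_embed_derived1 _ _ Dq.
Qed.

(** The displacement of [n] under [r] is a commutator of [n] with r^-1; this is how the action feeds
    elements of <a, b> into the next derived group. *)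
Lemma derived_displacement m n r :
  inl n \in derived_series m -> r \in derived_series m ->
  inl (n^-1 * phi r n) \in derived_series m.+1.
Proof.
move=> Dn Dr.
have -> : inl (n^-1 * phi r n) = [~ inl n, (inr r)^-1].
  by rewrite homM homV sdl_act commgEl conjgE invgK !mulgA.
exact/derivedR/derivedV/derived_hom.
Qed.

Lemma derived_free_gen m :
  inl a \in derived_series m -> inl b \in derived_series m ->
  forall n, inl n \in derived_series m.
Proof.
move=> Da Db; apply: presented_ind => [|n n' Dn Dn'|n Dn|].
- by rewrite hom1 derived1.
- by rewrite homM derivedM.
- by rewrite homV derivedV.
- exact: ord2_ind.
Qed.

(** The displacement of b under x is conjugate to a^-1, and that of a under y is a^-1 b. *)
Lemma derived1_free n : inl n \in derived_series 1.
Proof.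
have [xa xb ya yb] := braid3_actionE.
have Db : inl (b^-1 * a^-1 * b) \in derived_series 1.
  by rewrite -mulgA -xb derived_displacement.
have Da : inl a \in derived_series 1.
  have -> : inl a = ((inl (b^-1 * a^-1 * b)) ^ (inl b^-1))^-1.
    by rewrite conjgE -!homV -!homM -homV !gnorm.
  by rewrite derivedV ?derivedJ.
apply: derived_free_gen => //.
have := @derived_displacement 0 a y isT isT; rewrite ya => Dab.
by rewrite -[b](mulVKg a) homM derivedM.
Qed.

(** Only elements of the derived group of B3 may act now: u and v displace a by a^-1 b and a^-2 b,
    whose quotient is a. *)
Lemma derived2_free n : inl n \in derived_series 2.
Proof.
have [ua _ va _] := braid3_act_embed.
have := derived_displacement (derived1_free a) (braid3_embed_derived1 u).
have := derived_displacement (derived1_free a) (braid3_embed_derived1 v).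
rewrite ua va => Dv Du.
have Da : inl a \in derived_series 2.
  have -> : inl a = inl (a^-1 * b) * (inl (a^-1 * (a^-1 * b)))^-1.
    by rewrite -homV -homM !gnorm.
  by rewrite derivedM ?derivedV.
by apply: derived_free_gen => //; rewrite -[b](mulVKg a) homM derivedM.
Qed.

Lemma act_commutator : phi (iota [~ u^-1, v]) a = b^-1 * a^-1 * b.
Proof.
have [[xa xb ya yb] [xVa xVb yVa yVb]] := (braid3_actionE, braid3_actionVE).
have [iu iv] := braid3_embedE.
rewrite commgEl conjgE invgK !homM !homV iu iv !invgM !invgK.
by rewrite ?(actMq, actMn, (morph_groupV (actMn phi _)), xa, xb, ya, yb, xVa,
  xVb, yVa, yVb, gnorm).
Qed.

Lemma derived3_even n : inl (even_embed n) \in derived_series 3.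
Proof.
have [xa xb ya yb] := braid3_actionE; have [e1 e2 e3 e4 e5] := even_embedE.
have Daa : inl (a * a) \in derived_series 3.
  (* The displacement a^-1 b^-1 a^-1 b is a^-2 up to a commutator of elements of <a, b>, all of
     which lie in the second derived group. *)
  have -> : inl (a * a) = [~ inl b, inl a^-1]^-1 *
      (inl (a^-1 * phi (iota [~ u^-1, v]) a))^-1.
    by rewrite act_commutator -homR -!homV -homM commgEl conjgE !gnorm.
  rewrite derivedM ?derivedV ?derivedR ?derived2_free //.
  apply: derived_displacement; first exact: derived2_free.
  exact/braid3_embed_derived/derivedR.
have Dbb : inl (b * b) \in derived_series 3.
  (* Derived groups are normal, and y conjugates a to b. *)
  have -> : inl (b * b) = inl (a * a) ^ (inr y)^-1.
    by rewrite conjgE invgK mulgA -sdl_act actMn ya.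
  exact: derivedJ.
elim/presented_ind: n => [|m m' Dm Dm'|m Dm|].
- by rewrite !hom1 derived1.
- by rewrite !homM derivedM.
- by rewrite !homV derivedV.
apply: ord5_ind; rewrite -/(fgen _) ?e1 ?e2 ?e3 ?e4 ?e5 //.
- have -> : inl (a * b * a * b) =
      inl (a * a) * [~ inl a, inl b^-1] * inl (b * b).
    by rewrite -homR -!homM commgEl conjgE !gnorm.
  do 2!apply: (derivedM) => //.
  by apply: derivedR; apply: derived2_free.
- have -> : inl (b * a * a / b) = inl (a * a) ^ inl b^-1.
    by rewrite conjgE -!homV -!homM !gnorm.
  exact: derivedJ.
- have -> : inl (a * b * b / a) = inl (b * b) ^ inl a^-1.
    by rewrite conjgE -!homV -!homM !gnorm.
  exact: derivedJ.
Qed.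

(** Through [braid4_split] this is the classical surjection from B4 to B3 sending s1 and s3 to x and
    s2 to y. *)
Definition strand_hom : hom G B3 := Hom (@semidirect2M _ _ phi).

Lemma klein_mulC (p q : klein) : p * q = q * p.
Proof. by case: p q => [[] []] [[] []]. Qed.

(** On the second derived group the B3 coordinate acts trivially modulo 2, so the parity of the
    first coordinate is multiplicative there; its values commute, hence it kills commutators. *)
Lemma derived3_parity (z : G) : z \in derived_series 3 -> parity z.1 = 1.
Proof.
have fixS (w : G) : w \in derived_series 2 -> parity_action w.2 = 1.
  move=> /(derived_hom strand_hom) /derived_braid3 [q Dq wE].
  by rewrite -[w.2]/(strand_hom w) wE parity_action_derived.
have parityM (w w' : G) : parity_action w.2 = 1 ->
    parity (w * w').1 = parity w.1 * parity w'.1.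
  by move=> w1; rewrite /= homM parity_act w1.
move: z; apply: derivedS_min => [|w w' pw pw'|w w' Dw Dw']; first exact: hom1.
  rewrite /= homM !parity_act (homV parity) pw pw'.
  by rewrite invg1 !parity_action1 mulg1.
(* The commutator is compared through w w' = w' w [w, w'], which needs multiplicativity only for
   products. *)
apply: (mulgI (parity (w' * w).1)); rewrite mulg1.
apply: etrans (esym (parityM _ _ (fixS _ (derivedM Dw' Dw)))) _.
by rewrite -commgC !parityM ?fixS // klein_mulC.
Qed.

Lemma semidirect_embed_subproof :
  {morph (fun z : semidirect_group (derived_action even_action 2) =>
    braid4_join (even_embed z.1, iota (val z.2))) : z w / z * w}.
Proof.
move=> z w; rewrite -homM; congr (braid4_join (_, _)).
  by rewrite homM even_actionE.
by rewrite -[(z * w).2]/(z.2 * w.2) gmulfM homM.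
Qed.

Definition semidirect_embed :
  hom (semidirect_group (derived_action even_action 2)) B4 :=
  Hom semidirect_embed_subproof.

Lemma semidirect_embed_inj : injective semidirect_embed.
Proof.
move=> [n q] [m r] /(can_inj braid4_joinK) [/even_embed_inj -> qr].
by congr pair; apply/val_inj/braid3_embed_inj.
Qed.

Lemma semidirect_embed_derived (z : B4) :
  z \in derived_series 3 <-> exists w, z = semidirect_embed w.
Proof.
split=> [Dz|[[n q] ->]]; last first.
  pose w : G := (even_embed n, iota (val q)).
  apply: (@derived_hom _ _ _ _ w); rewrite [w]semidirectE; apply: derivedM.
    exact: derived3_even.
  (* [iota] raises the derived index by one, from 2 to 3; below, [derived_braid3] lowers it back. *)
  exact/derived_hom/braid3_embed_derived/(valP q).
have Dsz := derived_hom braid4_split Dz.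
have [q Dq qE] := derived_braid3 (derived_hom strand_hom Dsz).
exists (even_part (braid4_split z).1, Sub q Dq).
rewrite -[RHS]/(braid4_join (even_embed _, iota _)) /=.
rewrite even_partK; last exact: derived3_parity.
rewrite -qE -[LHS]braid4_splitK.
by congr (braid4_join _); case: (braid4_split z).
Qed.

Theorem proposition7 :
  let u : free_group 2 := fgen (ord 2 0) in
  let v : free_group 2 := fgen (ord 2 1) in
  let z1 : free_group 5 := fgen (ord 5 0) in
  let z2 : free_group 5 := fgen (ord 5 1) in
  let z3 : free_group 5 := fgen (ord 5 2) in
  let z4 : free_group 5 := fgen (ord 5 3) in
  let z5 : free_group 5 := fgen (ord 5 4) in
  let w1 : free_group 5 := z1^-1 * z3 * z2^-1 * z4^-1 * z2 in
  exists phi : group_action (free_group 2) (free_group 5),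
    [/\ [/\ phi u z1 = z2,
            phi u z2 = z2 * z1^-1 * z5 * z3 * z2^-1 * z4^-1 * z2,
            phi u z3 = z2 ^+ 2 * z3^-1 * z5 ^+ 2 * z3 * z2^-1 * z4^-1 * z2,
            phi u z4 = z2 * z1^-1 * z5 * z1 * z2^-1
          & phi u z5 = z2 ^+ 2 * z3^-1 * z5 ^+ 2],
        [/\ phi v z1 = w1,
            phi v z2 = w1 ^+ 2 * z3^-1 * z5 * z2 * z3^-1 * z5 * z4^-1 * z2,
            phi v z3 = w1 ^+ 2 * z1^-1 * (z2 * z3^-1 * z5) ^+ 2 * z4^-1 * z2,
            phi v z4 = w1 ^+ 2 * z3^-1 * z5 * z2 * w1 ^- 2
          & phi v z5 = w1 ^+ 2 * z1^-1 * (z2 * z3^-1 * z5) ^+ 2]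
      & isomorphic (derived_group braid_group4 3)
                   (semidirect (derived_action phi 2))].
Proof.
move=> u v z1 z2 z3 z4 z5 w1; exists even_action.
split; [exact: even_action_u|exact: even_action_v|].
exact: derived_isomorphic semidirect_embed_inj semidirect_embed_derived.
Qed.
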